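(* Let $\mathcal{I},\mathcal{J}$ be Borel ideals on $\omega$. The following are equivalent: (1) Player II has a winning strategy in $\mathfrak{G}(\mathcal{I},\mathcal{J})$; (2) Player I has a winning strategy in $\mathfrak{B}(\mathcal{I},\mathcal{J})$; (3) there is an $\mathcal{I}^+$-branching tree $T\subseteq\omega^{<\omega}$ such that $f[\omega]\in\mathcal{J}^+$ for every $f\in[T]$.
   Context: Ideals on $\omega$ are assumed to contain all finite sets; Borel refers to the topology on $\mathcal{P}(\omega)\cong 2^\omega$. $\mathcal{I}^+=\mathcal{P}(\omega)\setminus\mathcal{I}$, similarly $\mathcal{J}^+$. A tree is a nonempty $T\subseteq\omega^{<\omega}$ closed under initial segments, $[T]=\{f\in\omega^\omega: f\upharpoonright n\in T\text{ for all }n\}$, and $T$ is $\mathcal{I}^+$-branching if for every $t\in T$ the set $\{n: t^\frown\langle n\rangle\in T\}$ belongs to $\mathcal{I}^+$. The game $\mathfrak{G}(\mathcal{I},\mathcal{J})$: at round $k$, Player I plays $I_k\in\mathcal{I}$ and then Player II plays $n_k\in\omega\setminus I_k$, with $n_0<n_1<\cdots$; Player II wins iff $\{n_k:k\in\omega\}\in\mathcal{J}^+$. The game $\mathfrak{B}(\mathcal{I},\mathcal{J})$: at round $k$, Player I plays $n_k\in\omega$ with $n_0<n_1<\cdots$, then Player II plays $i_k\in\{0,1\}$; Player II wins iff $\{n_k:k\in\omega\}\in\mathcal{I}$ or $\{n_k:i_k=1\}$ is infinite and belongs to $\mathcal{J}$. *)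

(* Defs.v *)
From Stdlib Require Import List Arith.
Import ListNotations.

Definition natset := nat -> Prop.

Definition finite_set (A : natset) : Prop := exists N, forall n, A n -> n < N.

Definition is_ideal (I : natset -> Prop) : Prop :=
  (forall A, finite_set A -> I A) /\
  (forall A B, I A -> (forall n, B n -> A n) -> I B) /\
  (forall A B, I A -> I B -> I (fun n => A n \/ B n)) /\
  ~ I (fun _ => True).

Definition positive (I : natset -> Prop) (A : natset) : Prop := ~ I A.

Definition cantor_open (U : (nat -> bool) -> Prop) : Prop :=
  forall x, U x -> exists n, forall y, (forall i, i < n -> y i = x i) -> U y.

Inductive cantor_borel : ((nat -> bool) -> Prop) -> Prop :=
| cb_open U : cantor_open U -> cantor_borel U
| cb_compl U : cantor_borel U -> cantor_borel (fun x => ~ U x)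
| cb_union (U : nat -> (nat -> bool) -> Prop) :
    (forall k, cantor_borel (U k)) -> cantor_borel (fun x => exists k, U k x)
| cb_ext U V : cantor_borel U -> (forall x, U x <-> V x) -> cantor_borel V.

(* A family of subsets of omega is Borel via P(omega) ~ 2^omega,
   A |-> characteristic function. *)
Definition borel_family (I : natset -> Prop) : Prop :=
  cantor_borel (fun x => I (fun n => x n = true)).

Definition restr {A : Type} (f : nat -> A) (n : nat) : list A := map f (seq 0 n).

Definition range (f : nat -> nat) : natset := fun m => exists k, f k = m.

(* A strategy for Player II: given Player I's moves I_0..I_k (a list of length
   k+1) it returns n_k.  (II's own earlier moves are determined by I's moves.) *)
Definition G_strategy_II := list natset -> nat.

Definition G_play (s : G_strategy_II) (X : nat -> natset) (k : nat) : nat :=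
  s (restr X (S k)).

Definition G_II_winning (I J : natset -> Prop) (s : G_strategy_II) : Prop :=
  forall X : nat -> natset, (forall k, I (X k)) ->
    (forall k, ~ X k (G_play s X k)) /\
    (forall k, G_play s X k < G_play s X (S k)) /\
    positive J (range (G_play s X)).

Definition II_wins_G (I J : natset -> Prop) : Prop :=
  exists s, G_II_winning I J s.

(* A strategy for Player I: given II's previous bits i_0..i_{k-1}, returns n_k. *)
Definition B_strategy_I := list bool -> nat.

Definition B_play (t : B_strategy_I) (b : nat -> bool) (k : nat) : nat :=
  t (restr b k).

Definition B_II_wins_play (I J : natset -> Prop) (n : nat -> nat) (b : nat -> bool)
  : Prop :=
  I (range n) \/
  (let S := fun m => exists k, b k = true /\ n k = m in ~ finite_set S /\ J S).

Definition B_I_winning (I J : natset -> Prop) (t : B_strategy_I) : Prop :=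
  forall b : nat -> bool,
    (forall k, B_play t b k < B_play t b (S k)) /\
    ~ B_II_wins_play I J (B_play t b) b.

Definition I_wins_B (I J : natset -> Prop) : Prop :=
  exists t, B_I_winning I J t.

Definition is_tree (T : list nat -> Prop) : Prop :=
  (exists t, T t) /\ (forall s r, T (s ++ r) -> T s).

Definition branching (I : natset -> Prop) (T : list nat -> Prop) : Prop :=
  forall t, T t -> positive I (fun n => T (t ++ [n])).

Definition body (T : list nat -> Prop) (f : nat -> nat) : Prop :=
  forall n, T (restr f n).

(* Main.v *)
Require Import Defs.
From Stdlib Require Import List.
From Stdlib Require Import Arith Cantor Lia Classical ClassicalEpsilon IndefiniteDescription.
Import ListNotations.

(** The implications (1) -> (3) and (2) -> (1) hold for arbitrary ideals: a winning
    strategy is unfolded along one chosen witness per move.  For (3) -> (2), Player I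
    offers the successors of the current node [t] of the tree in increasing order
    until one of them, [n], is accepted, then offers a whole interval of integers
    whatever the answers, and continues from [t ++ [n]].  If only finitely many
    nodes are reached, the offered set contains almost all successors of the last
    one.  Otherwise the accepted set contains the range of a branch, and the
    offered set contains infinitely many of the intervals.  By the theorem of
    Jalali-Naini and Talagrand the intervals can be chosen so that the latter
    forces the offered set to be [I]-positive; this is the only use of Borelness. *)

(** * Prefixes of sequences, ideals modulo finite sets, increasing sequences *)

Lemma restr_S {A : Type} (f : nat -> A) (n : nat) :
  restr f (S n) = restr f n ++ [f n].
Proof. unfold restr. now rewrite seq_S, map_app. Qed.

Lemma restr_length {A : Type} (f : nat -> A) (n : nat) : length (restr f n) = n.
Proof. unfold restr. now rewrite length_map, length_seq. Qed.

Lemma restr_plus {A : Type} (f : nat -> A) (n m : nat) :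
  restr f (n + m) = restr f n ++ map f (seq n m).
Proof. unfold restr. now rewrite seq_app, map_app. Qed.

(** Used to pad a finite list of moves or answers to an infinite sequence. *)
Lemma restr_nth {A : Type} (l : list A) (d : A) :
  restr (fun i => nth i l d) (length l) = l.
Proof.
  apply nth_ext with (d := d) (d' := d); [apply restr_length|].
  intros n Hn. rewrite restr_length in Hn. unfold restr.
  rewrite nth_indep with (d' := (fun i => nth i l d) 0)
    by (rewrite length_map, length_seq; lia).
  rewrite (map_nth (fun i => nth i l d)), seq_nth by lia. reflexivity.
Qed.

Lemma restr_ext {A : Type} (f g : nat -> A) (n : nat) :
  (forall i, i < n -> f i = g i) -> restr f n = restr g n.
Proof.
  intros H. apply map_ext_in. intros i Hi. apply in_seq in Hi. apply H. lia.
Qed.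

Lemma map_const_seq {A : Type} (f : nat -> A) (v : A) (n m : nat) :
  (forall i, n <= i < n + m -> f i = v) -> map f (seq n m) = repeat v m.
Proof.
  revert n. induction m as [|m IH]; intros n H; simpl; [reflexivity|].
  rewrite H by lia. f_equal. apply IH. intros i Hi. apply H. lia.
Qed.

Lemma ideal_mono (I : natset -> Prop) (A B : natset) :
  is_ideal I -> I A -> (forall n, B n -> A n) -> I B.
Proof. intros (_ & H & _) HA HB. exact (H A B HA HB). Qed.

Lemma ideal_bounded_mono (I : natset -> Prop) (A B : natset) (N : nat) :
  is_ideal I -> I A -> (forall n, B n -> N <= n -> A n) -> I B.
Proof.
  intros HI HA HB. destruct HI as (Hfin & Hsub & Hun & _).
  apply Hsub with (A := fun n => A n \/ n < N).
  - apply Hun; [assumption|]. apply Hfin. now exists N.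
  - intros n Hn. destruct (le_lt_dec N n); auto.
Qed.

Lemma strict_mono_lt (f : nat -> nat) :
  (forall k, f k < f (S k)) -> forall i j, i < j -> f i < f j.
Proof.
  intros Hf i j Hij. induction Hij as [|j _ IH]; [apply Hf|]. specialize (Hf j). lia.
Qed.

Lemma strict_mono_ge (f : nat -> nat) :
  (forall k, f k < f (S k)) -> forall k, k <= f k.
Proof.
  intros Hf k. induction k as [|k IH]; [lia|]. specialize (Hf k). lia.
Qed.

(** * Baire category in the Cantor space *)

Definition agree (n : nat) (x y : nat -> bool) : Prop := forall i, i < n -> y i = x i.

Definition dense_open (U : (nat -> bool) -> Prop) : Prop :=
  cantor_open U /\ forall x n, exists y, agree n x y /\ U y.

Lemma dense_open_and (U V : (nat -> bool) -> Prop) :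
  dense_open U -> dense_open V -> dense_open (fun x => U x /\ V x).
Proof.
  intros [HU DU] [HV DV]. split.
  - intros x [Ux Vx]. destruct (HU x Ux) as [n Hn], (HV x Vx) as [m Hm].
    exists (max n m). intros y Hy. split; [apply Hn | apply Hm];
      intros i Hi; apply Hy; lia.
  - intros x n. destruct (DU x n) as (y & Hy & Uy). destruct (HU y Uy) as [m Hm].
    destruct (DV y (max n m)) as (z & Hz & Vz). exists z. repeat split; [|apply Hm|exact Vz].
    + intros i Hi. rewrite Hz by lia. now apply Hy.
    + intros i Hi. apply Hz. lia.
Qed.

Lemma dense_open_initial (D : nat -> (nat -> bool) -> Prop) (N : nat) :
  (forall n, dense_open (D n)) -> dense_open (fun x => forall n, n < N -> D n x).
Proof.
  intros HD. induction N as [|N IH].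
  - split.
    + intros x _. exists 0. intros y _ n Hn. lia.
    + intros x n. exists x. split; [intros i _; reflexivity | intros k Hk; lia].
  - destruct (dense_open_and _ _ IH (HD N)) as [Ho Hd]. split.
    + intros x Hx. destruct (Ho x) as [n Hn]; [split; intros; apply Hx; lia|].
      exists n. intros y Hy k Hk. destruct (Hn y Hy) as [H1 H2].
      destruct (Nat.eq_dec k N) as [->|]; [exact H2 | apply H1; lia].
    + intros x n. destruct (Hd x n) as (y & Hy & H1 & H2). exists y. split; [exact Hy|].
      intros k Hk. destruct (Nat.eq_dec k N) as [->|]; [exact H2 | apply H1; lia].
Qed.

Lemma finitely_many_prefixes (a : nat) :
  exists L : list (nat -> bool), forall y, exists x, In x L /\ agree a x y.
Proof.
  induction a as [|a [L HL]].
  - exists [fun _ => true]. intros y. exists (fun _ => true). split; [now left|].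
    intros i Hi. lia.
  - exists (flat_map (fun x => [ (fun i => if i =? a then true else x i);
                                 (fun i => if i =? a then false else x i)]) L).
    intros y. destruct (HL y) as (x & Hx & Hxy).
    exists (fun i => if i =? a then y a else x i). split.
    + apply in_flat_map. exists x. split; [exact Hx|].
      destruct (y a); simpl; auto.
    + intros i Hi. destruct (Nat.eqb_spec i a) as [->|]; [reflexivity|]. apply Hxy. lia.
Qed.

(** The prefixes are treated one after another: the block found so far is lengthened until the next
    prefix followed by it enters [D], which keeps the earlier prefixes in [D]. *)
Lemma dense_open_block_list (D : (nat -> bool) -> Prop) (a : nat) (L : list (nat -> bool)) :
  dense_open D ->
  exists m (s : nat -> bool), a < m /\
    forall x, In x L -> forall y, agree a x y ->
      (forall i, a <= i < m -> y i = s i) -> D y.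
Proof.
  intros [Ho Hd]. induction L as [|x L (m & s & Hm & IH)].
  - exists (S a), (fun _ => true). split; [lia|]. intros x [].
  - destruct (Hd (fun i => if i <? a then x i else s i) m) as (w & Hw & Dw).
    destruct (Ho w Dw) as [n Hn].
    exists (max m n), w. split; [lia|]. intros x' [<-|Hx'] y Hy Hyw.
    + apply Hn. intros i Hi. destruct (le_lt_dec a i).
      * apply Hyw. lia.
      * rewrite Hy, Hw by lia. now destruct (Nat.ltb_spec i a); [|lia].
    + apply (IH x' Hx' y Hy). intros i Hi. rewrite Hyw, Hw by lia.
      now destruct (Nat.ltb_spec i a); [lia|].
Qed.

(** There are only finitely many prefixes of length [a], so a single block serves all of them. *)
Lemma dense_open_block (D : (nat -> bool) -> Prop) (a : nat) :
  dense_open D ->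
  exists p : nat * (nat -> bool), a < fst p /\
    forall y, (forall i, a <= i < fst p -> y i = snd p i) -> D y.
Proof.
  intros HD. destruct (finitely_many_prefixes a) as [L HL].
  destruct (dense_open_block_list D a L HD) as (m & s & Hm & H).
  exists (m, s). split; [exact Hm|]. intros y Hy. destruct (HL y) as (x & Hx & Hxy).
  now apply (H x).
Qed.

(** The block starting at [a] forces membership in [D n] for all [n < a], so matching infinitely
    many blocks puts [y] in every [D n]. *)
Lemma generic_blocks (D : nat -> (nat -> bool) -> Prop) :
  (forall n, dense_open (D n)) ->
  exists (e : nat -> nat) (s : nat -> nat -> bool),
    (forall a, a < e a) /\
    forall y, (forall N, exists a, N <= a /\ forall i, a <= i < e a -> y i = s a i) ->
      forall n, D n y.
Proof.
  intros HD.
  destruct (functional_choice _ (fun a =>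
    dense_open_block _ a (dense_open_initial D a HD))) as [p Hp].
  exists (fun a => fst (p a)), (fun a => snd (p a)). split; [intros a; apply Hp|].
  intros y Hy n. destruct (Hy (S n)) as (a & Ha & Hya).
  apply (proj2 (Hp a) y Hya). lia.
Qed.

(** The blocks from [a k] to [e (a k)] are pairwise disjoint, so their prescriptions do not
    conflict. *)
Lemma fill_blocks (e a : nat -> nat) (s : nat -> nat -> bool) (x : nat -> bool) :
  (forall k, a k < e (a k)) -> (forall k, e (a k) <= a (S k)) ->
  exists y : nat -> bool,
    (forall k i, a k <= i < e (a k) -> y i = s (a k) i) /\
    (forall i, (forall k, ~ a k <= i < e (a k)) -> y i = x i).
Proof.
  intros He Ha.
  assert (Hmono : forall j k, j < k -> e (a j) <= a k).
  { intros j k Hjk. induction Hjk as [|k _ IH]; [apply Ha|].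
    specialize (He k). specialize (Ha k). lia. }
  destruct (functional_choice (fun i v =>
    (forall k, a k <= i < e (a k) -> v = s (a k) i) /\
    ((forall k, ~ a k <= i < e (a k)) -> v = x i))) as [y Hy].
  - intros i. destruct (classic (exists k, a k <= i < e (a k))) as [[k Hk]|Hn].
    + exists (s (a k) i). split; [|intros H; now destruct (H k)].
      intros j Hj. destruct (lt_eq_lt_dec j k) as [[H| ->]|H]; [|reflexivity|];
        apply Hmono in H; lia.
    + exists (x i). split; [|reflexivity]. intros k Hk. destruct Hn. now exists k.
  - exists y. split; intros; now apply Hy.
Qed.

Lemma baire (D : nat -> (nat -> bool) -> Prop) (x : nat -> bool) (n : nat) :
  (forall k, dense_open (D k)) -> exists y, agree n x y /\ forall k, D k y.
Proof.
  intros HD. destruct (generic_blocks D HD) as (e & s & He & Hgen).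
  (* Blocks are laid end to end from [n] on, leaving the first [n] values of [x] untouched. *)
  set (a := fun k => Nat.iter k e n).
  assert (Hge : forall k, n <= a k).
  { intros k. induction k as [|k IH]; simpl; [lia|]. specialize (He (a k)).
    unfold a in *. simpl. lia. }
  assert (Hk : forall k, k <= a k) by (apply strict_mono_ge; intros k; apply He).
  destruct (fill_blocks e a s x) as (y & Hy & Hyx); [auto|simpl; auto|].
  exists y. split.
  - intros i Hi. apply Hyx. intros k Hki. specialize (Hge k). lia.
  - apply Hgen. intros N. exists (a N). split; [apply Hk|]. apply Hy.
Qed.

(* A form of the Baire property: the characteristic function of a Borel set is
   continuous on a countable intersection of dense open sets. *)
Lemma borel_continuous_on_comeager (S : (nat -> bool) -> Prop) :
  cantor_borel S ->
  exists D : nat -> (nat -> bool) -> Prop,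
    (forall k, dense_open (D k)) /\
    forall x, (forall k, D k x) -> exists n, forall y,
      (forall k, D k y) -> agree n x y -> (S x <-> S y).
Proof.
  induction 1 as [U HU | U _ (D & HD & HS) | U _ IH | U V _ (D & HD & HS) HUV].
  (* For open [U], every [D k] is the union of [U] and the interior of its complement. *)
  - exists (fun _ x => U x \/ exists n, forall y, agree n x y -> ~ U y). split.
    + intros _. split.
      * intros x [Ux|[n Hn]].
        -- destruct (HU x Ux) as [n Hn]. exists n. intros y Hy. left. now apply Hn.
        -- exists n. intros y Hy. right. exists n. intros z Hz. apply Hn.
           intros i Hi. rewrite Hz by exact Hi. now apply Hy.
      * intros x n. destruct (classic (exists y, agree n x y /\ U y)) as [(y & Hy & Uy)|Hno].
        -- exists y. auto.
        -- exists x. split; [intros i _; reflexivity|]. right. exists n. intros y Hy Uy.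
           apply Hno. now exists y.
    + intros x Hx. destruct (Hx 0) as [Ux|[n Hn]].
      * destruct (HU x Ux) as [n Hn]. exists n. intros y _ Hy.
        split; intros _; [now apply Hn | exact Ux].
      * exists n. intros y _ Hy. split; intros HUz; exfalso.
        -- now apply (Hn x).
        -- now apply (Hn y).
  - exists D. split; [exact HD|]. intros x Hx. destruct (HS x Hx) as [n Hn].
    exists n. intros y Dy Hy. specialize (Hn y Dy Hy). tauto.
  - destruct (functional_choice _ IH) as [D HD].
    set (G := fun x => forall k j, D k j x).
    set (W := fun x => exists k, U k x).
    (* [E] collects the points near which membership in [W] is constant on the generic set [G]. Near
       a generic point of [W], this follows from the continuity of some [U k] there. *)
    set (E := fun x => exists n,
      (forall y, G y -> agree n x y -> W y) \/ (forall y, G y -> agree n x y -> ~ W y)).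
    assert (HE : dense_open E).
    { split.
      - intros x [n Hn]. exists n. intros y Hy. exists n.
        destruct Hn as [Hn|Hn]; [left|right]; intros z Gz Hz; apply (Hn z Gz);
          intros i Hi; (rewrite Hz by exact Hi); now apply Hy.
      - intros x n. destruct (classic (exists y, agree n x y /\ G y /\ W y))
          as [(y & Hy & Gy & k & Hk)|Hno].
        + exists y. split; [exact Hy|].
          destruct (proj2 (HD k) y (Gy k)) as [m Hm]. exists m. left.
          intros z Gz Hz. exists k. now apply (Hm z (Gz k) Hz).
        + exists x. split; [intros i _; reflexivity|]. exists n. right.
          intros y Gy Hy Wy. apply Hno. now exists y. }
    (* Index 0 carries [E]; the other indices enumerate all [D k j] by Cantor pairing. *)
    exists (fun k => match k with
                     | 0 => E
                     | Datatypes.S p => D (fst (Cantor.of_nat p)) (snd (Cantor.of_nat p))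
                     end).
    split; [intros [|p]; [exact HE | apply HD]|].
    assert (HG : forall x, (forall k, match k with
                     | 0 => E
                     | Datatypes.S p => D (fst (Cantor.of_nat p)) (snd (Cantor.of_nat p))
                     end x) -> G x).
    { intros x Hx k j. specialize (Hx (Datatypes.S (Cantor.to_nat (k, j)))).
      cbv beta iota in Hx. now rewrite Cantor.cancel_of_to in Hx. }
    intros x Hx. destruct (Hx 0) as [n Hn]. exists n. intros y Hy Hxy.
    assert (Hxx : agree n x x) by (intros i _; reflexivity).
    apply HG in Hx. apply HG in Hy.
    destruct Hn as [Hn|Hn]; specialize (Hn x Hx Hxx) as H1; specialize (Hn y Hy Hxy) as H2;
      unfold W in H1, H2; tauto.
  - exists D. split; [exact HD|]. intros x Hx. destruct (HS x Hx) as [n Hn].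
    exists n. intros y Dy Hy. rewrite <- !HUV. now apply Hn.
Qed.

(** * Borel ideals are meager; the theorem of Jalali-Naini and Talagrand *)

Definition flip_from (n : nat) (x : nat -> bool) (i : nat) : bool :=
  if i <? n then x i else negb (x i).

Lemma flip_from_involutive (n : nat) (x : nat -> bool) (i : nat) :
  flip_from n (flip_from n x) i = x i.
Proof.
  unfold flip_from. destruct (i <? n); [reflexivity | apply Bool.negb_involutive].
Qed.

(** The flip is a self-inverse homeomorphism of the Cantor space. *)
Lemma dense_open_flip (n : nat) (D : (nat -> bool) -> Prop) :
  dense_open D -> dense_open (fun x => D (flip_from n x)).
Proof.
  intros [Ho Hd].
  assert (Hag : forall m x y, agree m x y -> agree m (flip_from n x) (flip_from n y)).
  { intros m x y Hxy i Hi. unfold flip_from. now rewrite Hxy. }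
  split.
  - intros x Hx. destruct (Ho _ Hx) as [m Hm]. exists m. intros y Hy.
    apply Hm. now apply Hag.
  - intros x m. destruct (Hd (flip_from n x) m) as (y & Hy & Dy).
    exists (flip_from n y). split.
    + intros i Hi. rewrite (Hag _ _ _ Hy) by exact Hi. apply flip_from_involutive.
    (* The double flip agrees with [y] only pointwise; openness of [D] transfers membership. *)
    + destruct (Ho y Dy) as [k Hk]. apply Hk. intros i _. apply flip_from_involutive.
Qed.

(** If a generic point were in [I], continuity would put all nearby generic points in [I], which is
    too many for a proper ideal. *)
Lemma borel_ideal_meager (I : natset -> Prop) :
  is_ideal I -> borel_family I ->
  exists D : nat -> (nat -> bool) -> Prop,
    (forall k, dense_open (D k)) /\
    forall x, (forall k, D k x) -> ~ I (fun n => x n = true).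
Proof.
  intros HI HB. destruct (borel_continuous_on_comeager _ HB) as (D & HD & Hcont).
  exists D. split; [exact HD|]. intros x Hx Ix.
  destruct (Hcont x Hx) as [n Hn].
  (* a generic [y] near [x] whose reflection above [n] is also generic: both lie
     in [I], while their union is cofinite *)
  destruct (baire (fun k z => D k z /\ D k (flip_from n z)) x n) as (y & Hxy & Hy).
  { intros k. apply dense_open_and; [apply HD | apply dense_open_flip, HD]. }
  assert (Iy : I (fun i => y i = true)) by (apply (Hn y); [apply Hy | exact Hxy | exact Ix]).
  assert (If : I (fun i => flip_from n y i = true)).
  { apply (Hn (flip_from n y)); [apply Hy | | exact Ix].
    intros i Hi. unfold flip_from. destruct (Nat.ltb_spec i n); [now apply Hxy | lia]. }
  assert (Hun := proj1 (proj2 (proj2 HI)) _ _ Iy If).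
  apply (proj2 (proj2 (proj2 HI))).
  apply (ideal_bounded_mono I _ _ n HI Hun). intros i _ Hi.
  unfold flip_from. destruct (Nat.ltb_spec i n); [lia|]. destruct (y i); auto.
Qed.

(** On infinitely many blocks inside [A], copy the pattern [s], and put 0 elsewhere: the result is a
    generic subset of [A], hence [I]-positive, and so is [A]. *)
Theorem talagrand (I : natset -> Prop) :
  is_ideal I -> borel_family I ->
  exists e : nat -> nat, forall A : natset,
    (forall N, exists a, N <= a /\ forall i, a <= i < e a -> A i) -> positive I A.
Proof.
  intros HI HB. destruct (borel_ideal_meager I HI HB) as (D & HD & HDI).
  destruct (generic_blocks D HD) as (e & s & He & Hgen).
  exists e. intros A HA IA. destruct (functional_choice _ HA) as [g Hg].
  (* Each new block starts no earlier than the end [e b] of the previous one, so the chosen blocks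
     are disjoint. *)
  set (a := fun k => Nat.iter k (fun b => g (e b)) (g 0)).
  assert (Ha : forall k, e (a k) <= a (S k)) by (intros k; apply Hg).
  assert (HaA : forall k i, a k <= i < e (a k) -> A i).
  { intros [|k] i Hi; now apply Hg in Hi. }
  assert (Hk : forall k, k <= a k).
  { apply strict_mono_ge. intros k. specialize (He (a k)). specialize (Ha k). lia. }
  destruct (fill_blocks e a s (fun _ => false)) as (y & Hy & Hy0); [auto|exact Ha|].
  apply (HDI y).
  - apply Hgen. intros N. exists (a N). split; [apply Hk | apply Hy].
  - apply (ideal_mono I A); [exact HI | exact IA |]. intros i Hi.
    apply NNPP. intros HnA. rewrite Hy0 in Hi; [discriminate|].
    intros k Hki. now apply HnA, (HaA k).
Qed.

(** * From a strategy in G to a tree *)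

(** [epsilon] makes the choice total; it is meaningful only when [n] is a possible reply, as along
    [reply_tree]. *)
Definition witness (I : natset -> Prop) (s : G_strategy_II) (w : list natset) (n : nat)
  : natset :=
  epsilon (inhabits (fun _ => False)) (fun X => I X /\ s (w ++ [X]) = n).

Definition witnesses (I : natset -> Prop) (s : G_strategy_II) (t : list nat)
  : list natset :=
  fold_left (fun w n => w ++ [witness I s w n]) t [].

(** Quantifying over all splittings of [t] makes closure under initial segments immediate. *)
Definition reply_tree (I : natset -> Prop) (s : G_strategy_II) (t : list nat) : Prop :=
  forall u n v, t = u ++ n :: v -> exists X, I X /\ s (witnesses I s u ++ [X]) = n.

Lemma witnesses_snoc (I : natset -> Prop) (s : G_strategy_II) (t : list nat) (n : nat) :
  witnesses I s (t ++ [n]) = witnesses I s t ++ [witness I s (witnesses I s t) n].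
Proof. unfold witnesses. now rewrite fold_left_app. Qed.

Lemma witness_spec (I : natset -> Prop) (s : G_strategy_II) (t : list nat) (n : nat) :
  reply_tree I s (t ++ [n]) ->
  I (witness I s (witnesses I s t) n) /\
  s (witnesses I s t ++ [witness I s (witnesses I s t) n]) = n.
Proof.
  intros H. unfold witness. apply epsilon_spec. now apply (H t n []).
Qed.

Lemma reply_tree_prefix (I : natset -> Prop) (s : G_strategy_II) (t r : list nat) :
  reply_tree I s (t ++ r) -> reply_tree I s t.
Proof.
  intros H u n v ->. apply (H u n (v ++ r)). now rewrite <- app_assoc.
Qed.

Lemma reply_tree_snoc (I : natset -> Prop) (s : G_strategy_II) (t : list nat) (X : natset) :
  reply_tree I s t -> I X -> reply_tree I s (t ++ [s (witnesses I s t ++ [X])]).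
Proof.
  intros Ht HX u n v E. destruct v as [|m v] using rev_ind.
  - apply app_inj_tail in E. destruct E as [<- <-]. now exists X.
  - rewrite app_comm_cons, app_assoc in E. apply app_inj_tail in E.
    destruct E as [E _]. now apply (Ht u n v).
Qed.

Lemma witnesses_in_ideal (I : natset -> Prop) (s : G_strategy_II) (t : list nat) :
  reply_tree I s t -> forall X, In X (witnesses I s t) -> I X.
Proof.
  induction t as [|n t IH] using rev_ind; intros Ht X HX; [destruct HX|].
  rewrite witnesses_snoc in HX. apply in_app_or in HX. destruct HX as [HX|[<-|[]]].
  - apply IH; [now apply reply_tree_prefix in Ht | exact HX].
  - now apply witness_spec.
Qed.

(** If the successors of [t] formed a set in [I], Player I could play that set, and the reply would
    be a successor of [t] outside it. Along a branch, the witnesses form a legal play whose replies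
    are that branch. *)
Lemma G_strategy_tree (I J : natset -> Prop) :
  is_ideal J -> II_wins_G I J ->
  exists T : list nat -> Prop,
    is_tree T /\ branching I T /\ forall f, body T f -> positive J (range f).
Proof.
  intros HJ [s Hs]. exists (reply_tree I s). split; [split|split].
  - exists []. intros u n v E. now destruct u.
  - apply reply_tree_prefix.
  - intros t Ht HA. set (A := fun n => reply_tree I s (t ++ [n])) in HA.
    set (w := witnesses I s t).
    (* Player I plays the witnesses for [t] and then, by the default of [nth], the set [A]
       forever. *)
    destruct (Hs (fun i => nth i w A)) as [Hleg _].
    + intros k. destruct (nth_in_or_default k w A) as [Hin| ->]; [|exact HA].
      now apply (witnesses_in_ideal I s t).
    + specialize (Hleg (length w)). unfold G_play in Hleg.
      rewrite restr_S, restr_nth, nth_overflow in Hleg by lia.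
      apply Hleg. now apply reply_tree_snoc.
  - intros f Hf HR. set (X := fun k => witness I s (witnesses I s (restr f k)) (f k)).
    assert (HX : forall k, restr X k = witnesses I s (restr f k)).
    { induction k as [|k IH]; [reflexivity|].
      now rewrite !restr_S, witnesses_snoc, IH. }
    assert (Hspec : forall k, I (X k) /\ G_play s X k = f k).
    { intros k. unfold G_play. rewrite restr_S, HX. apply witness_spec.
      rewrite <- restr_S. apply Hf. }
    destruct (Hs X) as (_ & _ & Hpos); [apply Hspec|].
    apply Hpos, (ideal_mono J (range f)); [exact HJ | exact HR |].
    intros m [k <-]. exists k. symmetry. apply Hspec.
Qed.

(** * From a strategy in B to a strategy in G *)

(** A number of refusals after which the offer falls outside [X], not necessarily the least one. *)
Definition rejections (t : B_strategy_I) (c : list bool) (X : natset) : nat :=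
  epsilon (inhabits 0) (fun j => ~ X (t (c ++ repeat false j))).

(** Each move [X] in G becomes a series of refusals in B followed by one acceptance. *)
Definition answers (t : B_strategy_I) (Xs : list natset) : list bool :=
  fold_left (fun c X => c ++ repeat false (rejections t c X) ++ [true]) Xs [].

Lemma answers_snoc (t : B_strategy_I) (Xs : list natset) (X : natset) :
  answers t (Xs ++ [X]) =
  (answers t Xs ++ repeat false (rejections t (answers t Xs) X)) ++ [true].
Proof. unfold answers. rewrite fold_left_app. simpl. now rewrite app_assoc. Qed.

(** Were every later offer in [X], refusing forever would put the offered set in [I], and Player II
    would win. *)
Lemma rejections_spec (I J : natset -> Prop) (t : B_strategy_I) (c : list bool) (X : natset) :
  is_ideal I -> B_I_winning I J t -> I X ->
  ~ X (t (c ++ repeat false (rejections t c X))).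
Proof.
  intros HI Ht HX. unfold rejections. apply epsilon_spec. apply NNPP. intros Hno.
  set (b := fun i => nth i c false).
  destruct (Ht b) as [Hinc Hlose]. apply Hlose. left.
  apply (ideal_bounded_mono I X _ (B_play t b (length c)) HI HX).
  intros n [k <-] Hk.
  assert (Hle : length c <= k).
  { destruct (le_lt_dec (length c) k) as [|Hlt]; [assumption|].
    apply (strict_mono_lt _ Hinc) in Hlt. lia. }
  apply NNPP. intros HnX. apply Hno. exists (k - length c).
  replace (c ++ repeat false (k - length c)) with (restr b k); [exact HnX|].
  replace k with (length c + (k - length c)) at 1 by lia.
  rewrite restr_plus. f_equal; [apply restr_nth|].
  apply map_const_seq. intros i Hi. apply nth_overflow. lia.
Qed.

(** The replies in G are the integers accepted in a play of B. They form an infinite set, which is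
    [J]-positive because Player I wins that play. *)
Lemma B_strategy_G_strategy (I J : natset -> Prop) :
  is_ideal I -> is_ideal J -> I_wins_B I J -> II_wins_G I J.
Proof.
  (* The last bit accepts the integer just offered, so it is dropped to recover that offer. *)
  intros HI HJ [t Ht]. exists (fun Xs => t (removelast (answers t Xs))).
  intros X HX. set (n := G_play _ X).
  set (c := fun k => answers t (restr X k)).
  set (j := fun k => rejections t (c k) (X k)).
  (* The round of B in which the [k]-th acceptance occurs, both counted from 0. *)
  set (p := fun k => length (c k) + j k).
  assert (Hc : forall k, c (S k) = (c k ++ repeat false (j k)) ++ [true]).
  { intros k. unfold c. rewrite restr_S. apply answers_snoc. }
  assert (Hn : forall k, n k = t (c k ++ repeat false (j k))).
  { intros k. unfold n, G_play. fold (c (S k)). now rewrite Hc, removelast_last. }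
  assert (Hlen : forall k, length (c (S k)) = S (p k)).
  { intros k. rewrite Hc, !length_app, repeat_length. simpl. unfold p. lia. }
  assert (Hp : forall k, p k < p (S k)).
  { intros k. unfold p at 2. rewrite Hlen. lia. }
  (* The full answer sequence accepts exactly at the rounds [p k]; each [c k] turns out to be a
     prefix of it. *)
  destruct (functional_choice (fun i v => v = true <-> exists k, p k = i)) as [b Hb].
  { intros i. destruct (classic (exists k, p k = i)) as [H|H];
      [exists true | exists false]; intuition discriminate. }
  assert (Hgap : forall k i, length (c k) <= i < p k -> b i = false).
  { intros k i Hi. apply Bool.not_true_is_false. intros Hbi.
    apply Hb in Hbi. destruct Hbi as [l <-].
    destruct (le_lt_dec k l) as [Hkl|Hlk].
    - assert (p k <= p l); [|lia].
      apply Nat.lt_eq_cases in Hkl. destruct Hkl as [Hkl| ->]; [|lia].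
      apply (strict_mono_lt p Hp) in Hkl. lia.
    - destruct k as [|k]; [lia|]. rewrite Hlen in Hi.
      assert (p l <= p k); [|lia].
      destruct (Nat.eq_dec l k) as [->|]; [lia|].
      assert (Hl : l < k) by lia. apply (strict_mono_lt p Hp) in Hl. lia. }
  assert (Hext : forall k, restr b (length (c k)) = c k ->
                           restr b (p k) = c k ++ repeat false (j k)).
  { intros k Hk. unfold p. rewrite restr_plus, Hk. f_equal.
    apply map_const_seq. intros i Hi. now apply (Hgap k). }
  assert (Hrestr : forall k, restr b (length (c k)) = c k).
  { induction k as [|k IH]; [reflexivity|].
    rewrite Hlen, restr_S, Hext by exact IH. rewrite Hc. repeat f_equal.
    apply Hb. now exists k. }
  assert (Hplay : forall k, n k = B_play t b (p k)).
  { intros k. unfold B_play. now rewrite Hext, Hn. }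
  destruct (Ht b) as [Hinc Hlose].
  split; [|split].
  - intros k. rewrite Hn. apply (rejections_spec I J); auto.
  - intros k. rewrite !Hplay. apply (strict_mono_lt _ Hinc), Hp.
  - intros HR. apply Hlose. right. split.
    + intros [N HN].
      assert (HNN : B_play t b (p N) < N).
      { apply HN. exists (p N). split; [apply Hb; now exists N | reflexivity]. }
      assert (H1 := strict_mono_ge _ Hinc (p N)). assert (H2 := strict_mono_ge _ Hp N). lia.
    + apply (ideal_mono J (range n)); [exact HJ | exact HR |].
      intros m (i & Hi & <-). apply Hb in Hi. destruct Hi as [k <-].
      exists k. apply Hplay.
Qed.

(** * From a tree to a strategy in B *)

(* Player I stands at a node of the tree, has to play at least [low], and plays
   every integer below [goal] before offering successors of the node again. *)
Record state := State { node : list nat; low : nat; goal : nat }.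

Definition next_child (T : list nat -> Prop) (t : list nat) (m : nat) : nat :=
  epsilon (inhabits 0) (fun n => (m <= n /\ T (t ++ [n])) /\
                                 forall l, m <= l -> T (t ++ [l]) -> n <= l).

Definition move (T : list nat -> Prop) (st : state) : nat :=
  if low st <? goal st then low st else next_child T (node st) (low st).

(** Accepting a successor [n] schedules the interval from [S n] up to [e (S n)], excluded. Answers
    given while that interval is offered do not change the node. *)
Definition step (T : list nat -> Prop) (e : nat -> nat) (st : state) (i : bool) : state :=
  let n := move T st in
  if low st <? goal st then State (node st) (S n) (goal st)
  else if i then State (node st ++ [n]) (S n) (e (S n))
  else State (node st) (S n) (goal st).

Definition run (T : list nat -> Prop) (e : nat -> nat) (l : list bool) : state :=
  fold_left (step T e) l (State [] 0 0).

(** A positive set is unbounded, because the ideal contains all finite sets. *)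
Lemma next_child_spec (I : natset -> Prop) (T : list nat -> Prop) (t : list nat) (m : nat) :
  is_ideal I -> branching I T -> T t ->
  (m <= next_child T t m /\ T (t ++ [next_child T t m])) /\
  forall l, m <= l -> T (t ++ [l]) -> next_child T t m <= l.
Proof.
  intros HI HT Ht. unfold next_child. apply epsilon_spec.
  destruct (dec_inh_nat_subset_has_unique_least_element
              (fun n => m <= n /\ T (t ++ [n]))) as (n & [Hn Hmin] & _).
  - intros n. apply classic.
  - apply NNPP. intros Hno. apply (HT t Ht). apply (proj1 HI). exists m.
    intros n Hn. destruct (le_lt_dec m n); [|assumption]. destruct Hno. now exists n.
  - exists n. split; [exact Hn|]. intros l Hl HTl. now apply Hmin.
Qed.

(** * A run of the tree strategy against a fixed sequence of answers *)

Section Run.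

Context (I J : natset -> Prop) (T : list nat -> Prop) (e : nat -> nat) (b : nat -> bool).
Context (HI : is_ideal I) (HJ : is_ideal J).
Context (Htree : is_tree T) (Hbranch : branching I T).

Let st (k : nat) : state := run T e (restr b k).
Let n (k : nat) : nat := move T (st k).

(** Only acceptances of successors count; [b k] may also be true while an interval is being
    offered. *)
Definition accepts (k : nat) : Prop := goal (st k) <= low (st k) /\ b k = true.

Lemma st_S (k : nat) : st (S k) = step T e (st k) (b k).
Proof. unfold st, run. now rewrite restr_S, fold_left_app. Qed.

Lemma low_S (k : nat) : low (st (S k)) = S (n k).
Proof.
  rewrite st_S. unfold step. fold (n k).
  destruct (low (st k) <? goal (st k)); [|destruct (b k)]; reflexivity.
Qed.

Lemma accepts_step (k : nat) :
  accepts k -> st (S k) = State (node (st k) ++ [n k]) (S (n k)) (e (S (n k))).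
Proof.
  intros [H1 H2]. rewrite st_S. unfold step. fold (n k). rewrite H2.
  destruct (Nat.ltb_spec (low (st k)) (goal (st k))); [lia | reflexivity].
Qed.

Lemma not_accepts_step (k : nat) :
  ~ accepts k -> st (S k) = State (node (st k)) (S (n k)) (goal (st k)).
Proof.
  intros H. rewrite st_S. unfold step. fold (n k). unfold accepts in H.
  destruct (Nat.ltb_spec (low (st k)) (goal (st k))); [reflexivity|].
  destruct (b k); [tauto | reflexivity].
Qed.

Lemma T_node (k : nat) : T (node (st k)).
Proof.
  induction k as [|k IH].
  - destruct Htree as [[t Ht] Hpre]. exact (Hpre [] t Ht).
  - destruct (classic (accepts k)) as [H|H].
    + rewrite (accepts_step k H). destruct H as [H _]. simpl. unfold n, move.
      destruct (Nat.ltb_spec (low (st k)) (goal (st k))); [lia|].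
      now apply (next_child_spec I).
    + now rewrite (not_accepts_step k H).
Qed.

Lemma low_le_move (k : nat) : low (st k) <= n k.
Proof.
  unfold n, move. destruct (_ <? _); [lia|].
  apply (next_child_spec I); auto using T_node.
Qed.

Lemma move_increasing (k : nat) : n k < n (S k).
Proof. rewrite <- Nat.le_succ_l, <- low_S. apply low_le_move. Qed.

Lemma low_increasing (k : nat) : low (st k) < low (st (S k)).
Proof. rewrite low_S. assert (H := low_le_move k). lia. Qed.

(** Until [low] reaches [goal], each round raises [low] by one and leaves [goal] unchanged. *)
Lemma interval_offered (k : nat) :
  accepts k -> forall i, S (n k) <= i < e (S (n k)) -> range n i.
Proof.
  intros Hk.
  assert (H : forall d, S (n k) + d <= e (S (n k)) ->
    low (st (S k + d)) = S (n k) + d /\ goal (st (S k + d)) = e (S (n k))).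
  { induction d as [|d IH]; intros Hd.
    - now rewrite !Nat.add_0_r, (accepts_step k Hk).
    - destruct IH as [IH1 IH2]; [lia|].
      rewrite Nat.add_succ_r. rewrite not_accepts_step by (unfold accepts; lia).
      cbn [low goal]. unfold n at 1, move. rewrite IH1, IH2.
      destruct (Nat.ltb_spec (S (n k) + d) (e (S (n k)))); lia. }
  intros i Hi. exists (S k + (i - S (n k))).
  destruct (H (i - S (n k))) as [H1 H2]; [lia|].
  unfold n at 1. unfold move. rewrite H1, H2.
  destruct (Nat.ltb_spec (S (n k) + (i - S (n k))) (e (S (n k)))); lia.
Qed.

Lemma node_accepted (k x : nat) :
  In x (node (st k)) -> exists l, b l = true /\ n l = x.
Proof.
  induction k as [|k IH]; [intros []|].
  destruct (classic (accepts k)) as [H|H].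
  - rewrite (accepts_step k H). simpl. intros Hx. apply in_app_or in Hx.
    destruct Hx as [Hx|[<-|[]]]; [auto|]. exists k. split; [apply H | reflexivity].
  - rewrite (not_accepts_step k H). exact IH.
Qed.

Lemma node_extends (k l : nat) :
  k <= l -> exists r, node (st l) = node (st k) ++ r.
Proof.
  induction 1 as [|l _ [r IH]]; [exists []; now rewrite app_nil_r|].
  destruct (classic (accepts l)) as [H|H].
  - exists (r ++ [n l]). rewrite (accepts_step l H). simpl. now rewrite IH, app_assoc.
  - exists r. now rewrite (not_accepts_step l H).
Qed.

Lemma node_length_unbounded :
  (forall N, exists k, N <= k /\ accepts k) ->
  forall m, exists k, m <= length (node (st k)).
Proof.
  intros Hinf m. induction m as [|m [k Hk]]; [exists 0; lia|].
  destruct (Hinf k) as (l & Hl & Hacc). exists (S l).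
  rewrite (accepts_step l Hacc). simpl. rewrite length_app. simpl.
  destruct (node_extends k l Hl) as [r ->]. rewrite length_app. lia.
Qed.

(** The nodes reached extend one another and their lengths are unbounded, so they converge to a
    branch. *)
Lemma accepted_contains_branch :
  (forall N, exists k, N <= k /\ accepts k) ->
  exists f, body T f /\ forall x, range f x -> exists l, b l = true /\ n l = x.
Proof.
  intros Hinf.
  destruct (functional_choice _ (node_length_unbounded Hinf)) as [g Hg].
  (* Entry [i] is the same in every node long enough to have it. *)
  assert (Hcoh : forall i k, i < length (node (st k)) ->
    nth i (node (st k)) 0 = nth i (node (st (g (S i)))) 0).
  { intros i k Hi. specialize (Hg (S i)).
    destruct (le_ge_dec k (g (S i))) as [H|H]; apply node_extends in H;
      destruct H as [r ->]; rewrite app_nth1 by lia; reflexivity. }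
  set (f := fun i => nth i (node (st (g (S i)))) 0).
  exists f. split.
  - intros m. destruct Htree as [_ Hpre].
    apply Hpre with (r := map f (seq m (length (node (st (g m))) - m))).
    rewrite <- restr_plus, Nat.add_comm, Nat.sub_add by apply Hg.
    replace (restr f (length (node (st (g m))))) with (node (st (g m))).
    + apply T_node.
    + rewrite <- (restr_nth (node (st (g m))) 0) at 1.
      apply restr_ext. intros i Hi. now apply Hcoh.
  - intros x [i <-]. apply (node_accepted (g (S i))). apply nth_In. apply Hg.
Qed.

(** Without acceptances the node and [goal] stay fixed, while [low] grows past [goal]. *)
Lemma eventually_offering_children (N : nat) :
  (forall k, N <= k -> ~ accepts k) ->
  exists k0, forall k, k0 <= k ->
    goal (st k) <= low (st k) /\ b k = false /\ node (st k) = node (st k0).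
Proof.
  intros HN.
  assert (Hconst : forall k, N <= k -> goal (st k) = goal (st N) /\ node (st k) = node (st N)).
  { induction 1 as [|k Hk [IH1 IH2]]; [auto|]. now rewrite not_accepts_step by auto. }
  assert (Hlow := strict_mono_ge (fun k => low (st k)) low_increasing). simpl in Hlow.
  exists (max N (goal (st N))). intros k Hk.
  destruct (Hconst k) as [H1 H2]; [lia|].
  destruct (Hconst (max N (goal (st N)))) as [_ H3]; [lia|].
  assert (Hle : goal (st k) <= low (st k)) by (specialize (Hlow k); lia).
  repeat split; [exact Hle| |congruence].
  apply Bool.not_true_is_false. intros Hb. apply (HN k); [lia|]. now split.
Qed.

(** Each offer is the least available successor, so [x] is never jumped over, and [low] eventually
    exceeds [x]. *)
Lemma children_offered (k0 : nat) :
  (forall k, k0 <= k ->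
    goal (st k) <= low (st k) /\ b k = false /\ node (st k) = node (st k0)) ->
  forall x, T (node (st k0) ++ [x]) -> low (st k0) <= x -> range n x.
Proof.
  intros H x Hx Hlow.
  assert (Hd : forall d, range n x \/ low (st (k0 + d)) <= x).
  { induction d as [|d [IH|IH]]; [right; now rewrite Nat.add_0_r | now left |].
    destruct (H (k0 + d)) as (H1 & _ & H3); [lia|].
    assert (Hle : n (k0 + d) <= x).
    { unfold n, move. destruct (Nat.ltb_spec (low (st (k0 + d))) (goal (st (k0 + d)))); [lia|].
      apply (next_child_spec I); auto using T_node. now rewrite H3. }
    destruct (Nat.eq_dec (n (k0 + d)) x) as [E|E]; [left; now exists (k0 + d)|].
    right. rewrite Nat.add_succ_r, low_S. lia. }
  destruct (Hd (S x)) as [|Hle]; [assumption|].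
  assert (Hge := strict_mono_ge (fun k => low (st k)) low_increasing (k0 + S x)).
  simpl in Hge. lia.
Qed.

Lemma run_winning :
  (forall A : natset,
    (forall N, exists a, N <= a /\ forall i, a <= i < e a -> A i) -> positive I A) ->
  (forall f, body T f -> positive J (range f)) ->
  ~ B_II_wins_play I J n b.
Proof.
  intros He Hbody Hwin.
  destruct (classic (forall N, exists k, N <= k /\ accepts k)) as [Hinf|Hfin].
  - destruct Hwin as [HR|[_ HS]].
    + apply (He (range n)); [|exact HR]. intros N.
      destruct (Hinf N) as (k & Hk & Hacc). exists (S (n k)). split.
      * assert (H := strict_mono_ge n move_increasing k). lia.
      * now apply interval_offered.
    + destruct (accepted_contains_branch Hinf) as (f & Hf & Hfn).
      apply (Hbody f Hf). exact (ideal_mono J _ _ HJ HS Hfn).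
  - apply not_all_ex_not in Hfin. destruct Hfin as [N HN].
    destruct (eventually_offering_children N) as [k0 Hk0].
    { intros k Hk Hacc. apply HN. now exists k. }
    destruct Hwin as [HR|[HS _]].
    + apply (Hbranch (node (st k0)) (T_node k0)).
      apply (ideal_bounded_mono I (range n) _ (low (st k0)) HI HR).
      intros x Hx Hlow. now apply (children_offered k0 Hk0).
    (* Every answer from round [k0] on is a refusal, so the accepted integers lie below [n k0]. *)
    + apply HS. exists (n k0). intros x (k & Hb & <-).
      destruct (le_lt_dec k0 k) as [H|H].
      * destruct (Hk0 k H) as (_ & Hf & _). congruence.
      * now apply (strict_mono_lt n move_increasing).
Qed.

End Run.

Lemma tree_B_strategy (I J : natset -> Prop) (T : list nat -> Prop) :
  is_ideal I -> is_ideal J -> borel_family I ->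
  is_tree T -> branching I T -> (forall f, body T f -> positive J (range f)) ->
  I_wins_B I J.
Proof.
  intros HI HJ HB Htree Hbranch Hbody. destruct (talagrand I HI HB) as [e He].
  exists (fun l => move T (run T e l)). intros b. split.
  - exact (move_increasing I T e b HI Htree Hbranch).
  - exact (run_winning I J T e b HI HJ Htree Hbranch He Hbody).
Qed.

Theorem mainTheorem18 (I J : natset -> Prop) :
  is_ideal I -> is_ideal J -> borel_family I -> borel_family J ->
  (II_wins_G I J <-> I_wins_B I J) /\
  (I_wins_B I J <->
     exists T : list nat -> Prop,
       is_tree T /\ branching I T /\
       forall f, body T f -> positive J (range f)).
Proof.
  intros HI HJ HBI _.
  assert (H32 : (exists T : list nat -> Prop,
       is_tree T /\ branching I T /\
       forall f, body T f -> positive J (range f)) -> I_wins_B I J).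
  { intros (T & H1 & H2 & H3). now apply (tree_B_strategy I J T). }
  (* (1) gives (2) through the tree, and (2) gives (3) through a strategy in G. *)
  split; split; auto using G_strategy_tree, B_strategy_G_strategy.
Qed.
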